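(* Let $(\mathfrak{a},\bullet,\{-,-\})$ be a one-sided Poisson affgebra over a field $\mathbb{F}$. Then, for all $o\in\mathfrak{a}$, $(T_o\mathfrak{a},\cdot_o,[-,-])$ is a Poisson algebra, where, with operations $+,-$ taken in $T_o\mathfrak{a}$, $$a\cdot_o b=a\bullet b-a\bullet o+o\bullet o-o\bullet b,\qquad [a,b]=\{a,b\}-\{a,o\}+\{o,o\}-\{o,b\}.$$
   Context: **Poisson algebra.** A vector space $P$ over $\mathbb{F}$ with a Lie bracket $[-,-]$ and an associative bilinear product (not assumed commutative or unital) with $[xy,z]=x[y,z]+[x,z]y$ for all $x,y,z$. **Affine spaces.** An abelian heap is a set with a ternary operation $\langle -,-,-\rangle$ satisfying $\langle\langle a,b,c\rangle,d,e\rangle=\langle a,b,\langle c,d,e\rangle\rangle$, $\langle a,b,b\rangle=a=\langle b,b,a\rangle$ and $\langle a,b,c\rangle=\langle c,b,a\rangle$; one writes $\langle a,b,c,d,e\rangle=\langle\langle a,b,c\rangle,d,e\rangle$. An ($\mathbb{F}$-)affine space is a non-empty abelian heap $\mathfrak{a}$ with a map $\mathbb{F}\times\mathfrak{a}\times\mathfrak{a}\to\mathfrak{a}$, $(\alpha,a,b)\mapsto\alpha\triangleright_a b$, such that $\alpha\triangleright_a-$ is a heap morphism, $-\triangleright_a b$ is a heap morphism (with $\langle\alpha,\beta,\gamma\rangle=\alpha-\beta+\gamma$ on $\mathbb{F}$), $1\triangleright_a b=b$, $\alpha\triangleright_a(\beta\triangleright_a b)=(\alpha\beta)\triangleright_a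 b$, $0\triangleright_a b=a$, and $\alpha\triangleright_a b=\langle\alpha\triangleright_c b,\alpha\triangleright_c a,a\rangle$. An affine map is a heap morphism $f$ with $f(\alpha\triangleright_a b)=\alpha\triangleright_{f(a)}f(b)$; a bi-affine map is affine in each argument. For $o\in\mathfrak{a}$, the tangent space (fibre) $T_o\mathfrak{a}$ is the set $\mathfrak{a}$ with the vector space structure $a+b=\langle a,o,b\rangle$, $\alpha a=\alpha\triangleright_o a$, zero element $o$; then $\langle a,b,c\rangle=a-b+c$. **Associative affgebra.** An affine space with an associative bi-affine product $\bullet$. **Affine Lie bracket.** A bi-affine map $\{-,-\}\colon\mathfrak{a}\times\mathfrak{a}\to\mathfrak{a}$ with $\langle\{a,b\},\{a,a\},\{b,a\}\rangle=\{b,b\}$ and $\langle\{a,\{b,c\}\},\{a,\{a,a\}\},\{b,\{c,a\}\},\{b,\{b,b\}\},\{c,\{a,b\}\}\rangle=\{c,\{c,c\}\}$ for all $a,b,c$. **Deriffation.** For an affine map $D\colon\mathfrak{a}\to\mathfrak{a}$ on an associative affgebra, put $\Delta^D(a,b)=\langle D(a)\bullet b,D(a\bullet b),a\bullet D(b)\rangle$. $D$ is a deriffation if for all $o\in\mathfrak{a}$ and all $a,b\in\mathfrak{a}$, $\Delta^D(a,b)-\Delta^D(a,o)+\Delta^D(o,o)-\Delta^D(o,b)=o$ in $T_o\mathfrak{a}$. **One-sided Poisson affgebra.** An associative affgebra $(\mathfrak{a},\bullet)$ with an affine Lie bracket $\{-,-\}$ such that for all $z\in\mathfrak{a}$ the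 affine map $\{-,z\}$ is a deriffation on $\mathfrak{a}$. *)

(* Defs.v *)
From HB Require Import structures.
From mathcomp Require Import all_boot all_algebra.

Set Implicit Arguments.
Unset Strict Implicit.
Unset Printing Implicit Defensive.

Import GRing.Theory.
Local Open Scope ring_scope.

HB.mixin Record isAbelianHeap (A : Type) := {
  heap : A -> A -> A -> A;
  heapA : forall a b c d e : A,
    heap (heap a b c) d e = heap a b (heap c d e);
  heapKr : forall a b : A, heap a b b = a;
  heapKl : forall a b : A, heap b b a = a;
  heapC : forall a b c : A, heap a b c = heap c b a
}.

#[short(type="abelianHeapType")]
HB.structure Definition AbelianHeap := {A of isAbelianHeap A & Choice A}.

Definition heap5 (A : abelianHeapType) (a b c d e : A) : A :=
  heap (heap a b c) d e.

Definition heap_morphism (A B : abelianHeapType) (f : A -> B) : Prop :=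
  forall a b c : A, f (heap a b c) = heap (f a) (f b) (f c).

(* [act al a b] is the action of the scalar [al] on [b] with base point [a],  *)
(* written al |>_a b. *)
HB.mixin Record AbelianHeap_isAffineSpace (F : fieldType) (A : Type)
    of AbelianHeap A := {
  affine_inhabited : inhabited A;
  act : F -> A -> A -> A;
  act_heapr : forall (al : F) (a : A), heap_morphism (act al a);
  act_heapl : forall (al be ga : F) (a b : A),
    act (al - be + ga) a b = heap (act al a b) (act be a b) (act ga a b);
  act1 : forall a b : A, act 1 a b = b;
  actM : forall (al be : F) (a b : A), act al a (act be a b) = act (al * be) a b;
  act0 : forall a b : A, act 0 a b = a;
  act_base : forall (al : F) (a b c : A),
    act al a b = heap (act al c b) (act al c a) a
}.

#[short(type="affineSpaceType")]
HB.structure Definition AffineSpace (F : fieldType) :=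
  {A of AbelianHeap A & AbelianHeap_isAffineSpace F A}.

Definition affine_map (F : fieldType) (A B : affineSpaceType F) (f : A -> B)
    : Prop :=
  heap_morphism f /\
  forall (al : F) (a b : A), f (act al a b) = act al (f a) (f b).

Definition biaffine_map (F : fieldType) (A B C : affineSpaceType F)
    (f : A -> B -> C) : Prop :=
  (forall a : A, affine_map (f a)) /\ (forall b : B, affine_map (f^~ b)).

Definition tangent (F : fieldType) (A : affineSpaceType F) (o : A) : Type := A.

Section TangentSpace.

Variables (F : fieldType) (A : affineSpaceType F) (o : A).
Local Notation T := (tangent o).

HB.instance Definition _ := Choice.copy T A.

Let zeroT : T := o.
Let addT (a b : T) : T := heap (a : A) o (b : A).
Let oppT (a : T) : T := heap o (a : A) o.
Let scaleT (al : F) (a : T) : T := act al o (a : A).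

Fact tangent_addA : associative addT.
Proof. by move=> a b c; rewrite /addT heapA. Qed.

Fact tangent_addC : commutative addT.
Proof. by move=> a b; rewrite /addT heapC. Qed.

Fact tangent_add0 : left_id zeroT addT.
Proof. by move=> a; rewrite /addT heapKl. Qed.

Fact tangent_addN : left_inverse zeroT oppT addT.
Proof. by move=> a; rewrite /addT /oppT heapA heapKl heapKr. Qed.

HB.instance Definition _ :=
  GRing.isZmodule.Build T tangent_addA tangent_addC tangent_add0 tangent_addN.

Fact tangent_scaleA al be (a : T) : scaleT al (scaleT be a) = scaleT (al * be) a.
Proof. exact: actM. Qed.

Fact tangent_scale1 : left_id 1 scaleT.
Proof. by move=> a; exact: act1. Qed.

Fact tangent_scaleDr : right_distributive scaleT +%R.
Proof.
move=> al a b; rewrite /scaleT [LHS]act_heapr.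
by rewrite -[act al o o](congr1 (act al o) (act0 o o)) actM mulr0 act0.
Qed.

Fact tangent_scaleDl (a : T) : {morph scaleT^~ a : al be / al + be}.
Proof.
by move=> al be /=; rewrite /scaleT -[al]subr0 act_heapl act0 subr0.
Qed.

HB.instance Definition _ :=
  GRing.Zmodule_isLmodule.Build F T
    tangent_scaleA tangent_scale1 tangent_scaleDr tangent_scaleDl.

End TangentSpace.

(* The bilinear part of f at o: the casts make + and - those of T_o A. *)
Definition linearise (F : fieldType) (A : affineSpaceType F)
    (f : A -> A -> A) (o : A) (a b : tangent o) : tangent o :=
  (f a b : tangent o) - (f a o : tangent o)
  + (f o o : tangent o) - (f o b : tangent o).
Arguments linearise {F A} f o a b.

Definition associative_affgebra (F : fieldType) (A : affineSpaceType F)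
    (mul : A -> A -> A) : Prop :=
  biaffine_map mul /\ associative mul.

Definition affine_lie_bracket (F : fieldType) (A : affineSpaceType F)
    (br : A -> A -> A) : Prop :=
  [/\ biaffine_map br,
      forall a b : A, heap (br a b) (br a a) (br b a) = br b b
    & forall a b c : A,
        heap5 (br a (br b c)) (br a (br a a)) (br b (br c a))
              (br b (br b b)) (br c (br a b))
        = br c (br c c)].

Definition Delta (F : fieldType) (A : affineSpaceType F)
    (mul : A -> A -> A) (D : A -> A) (a b : A) : A :=
  heap (mul (D a) b) (D (mul a b)) (mul a (D b)).

Definition deriffation (F : fieldType) (A : affineSpaceType F)
    (mul : A -> A -> A) (D : A -> A) : Prop :=
  affine_map D /\
  forall (o : A) (a b : tangent o), linearise (Delta mul D) o a b = 0.

Definition one_sided_poisson_affgebra (F : fieldType) (A : affineSpaceType F)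
    (mul br : A -> A -> A) : Prop :=
  [/\ associative_affgebra mul, affine_lie_bracket br
    & forall z : A, deriffation mul (br^~ z)].

Definition bilinear_op (F : fieldType) (P : lmodType F) (f : P -> P -> P)
    : Prop :=
  (forall a : P, linear (f a)) /\ (forall b : P, linear (f^~ b)).

Definition lie_bracket (F : fieldType) (P : lmodType F) (br : P -> P -> P)
    : Prop :=
  [/\ bilinear_op br, forall a : P, br a a = 0
    & forall a b c : P, br a (br b c) + br b (br c a) + br c (br a b) = 0].

Definition poisson_algebra (F : fieldType) (P : lmodType F)
    (mul br : P -> P -> P) : Prop :=
  [/\ lie_bracket br, bilinear_op mul, associative mul
    & forall x y z : P, br (mul x y) z = mul x (br y z) + mul (br x z) y].

(* Main.v *)
(* On the tangent space at o a bi-affine map is its bilinear part plus terms   *)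
(* that depend on one argument only.  Hence a composite of two bi-affine maps  *)
(* is the composite of the bilinear parts modulo sums of functions of two of   *)
(* the three arguments, and a trilinear map which is such a sum vanishes.      *)
(* Associativity, the affine Jacobi identity and the deriffation condition     *)
(* each say that a combination of composites is such a sum.                    *)
Require Import Defs.
From HB Require Import structures.
From mathcomp Require Import all_boot all_algebra.

Set Implicit Arguments.
Unset Strict Implicit.
Unset Printing Implicit Defensive.

Import GRing.Theory.
Local Open Scope ring_scope.

(** [linearise f o] is the bilinear part of a bi-affine [f] at the origin [o], so bilinearity of
    both operations comes from [linearise_bilinear], and alternation is affine antisymmetry for the
    pair of [a] and [o]. Associativity, Jacobi and Leibniz share one argument. Modulo [pairwise]
    functions, a composite of the affine operations may be replaced by the composite of their
    bilinear parts ([linearise_compr], [linearise_compl]). The affine axiom makes the relevant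
    combination of composites zero or [pairwise], so its trilinear counterpart is [pairwise] too.
    Being zero as soon as one argument is zero, it vanishes by [pairwise_eq0]. *)

Section Pairwise.

Variable V : zmodType.

Lemma addr3_subBBB (x y z a b c : V) :
  x + y + z - ((x - a) + (y - b) + (z - c)) = a + b + c.
Proof.
by rewrite [x - a + _]addrACA -opprD [_ + (z - c)]addrACA -opprD subKr.
Qed.

Lemma subrD_subBBB (x y z a b c : V) :
  x - y + z - ((z - c) + (x - a) - (y - b)) = c + a - b.
Proof.
rewrite [z - c + _]addrACA -opprD [- (y - b)]opprD [z + x - _ + _]addrACA.
by rewrite -[_ - - b]opprD [x - y + z]addrAC [x + z]addrC subKr.
Qed.

Lemma subrD_eq (x y z a b c : V) :
  x - a + y - b + z = c -> x + y + z = a + b + c.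
Proof.
move=> <-; rewrite [x - a + y]addrAC -[x + y - a - b]addrA -opprD.
by rewrite [x + y - _ + z]addrAC [RHS]addrC subrK.
Qed.

Implicit Types (f g F G : V -> V -> V) (h k : V -> V -> V -> V).

Definition pairwise h : Prop :=
  exists p q r : V -> V -> V, forall a b c, h a b c = p a b + q b c + r c a.

Lemma eq_pairwise h k :
  (forall a b c, h a b c = k a b c) -> pairwise h -> pairwise k.
Proof. by move=> e [p [q [r E]]]; exists p, q, r => a b c; rewrite -e. Qed.

Lemma pairwiseD h k :
  pairwise h -> pairwise k -> pairwise (fun a b c => h a b c + k a b c).
Proof.
move=> [p [q [r E]]] [p' [q' [r' E']]].
exists (fun a b => p a b + p' a b), (fun a b => q a b + q' a b),
  (fun a b => r a b + r' a b) => a b c.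
by rewrite E E' addrACA [p a b + _ + _]addrACA.
Qed.

Lemma pairwiseN h : pairwise h -> pairwise (fun a b c => - h a b c).
Proof.
move=> [p [q [r E]]].
exists (fun a b => - p a b), (fun a b => - q a b), (fun a b => - r a b).
by move=> a b c; rewrite E !opprD.
Qed.

Lemma pairwiseB h k :
  pairwise h -> pairwise k -> pairwise (fun a b c => h a b c - k a b c).
Proof. by move=> hP kP; apply: pairwiseD => //; apply: pairwiseN. Qed.

Lemma pairwise_rot h : pairwise h -> pairwise (fun a b c => h b c a).
Proof.
move=> [p [q [r E]]]; exists r, p, q => a b c.
by rewrite E [LHS]addrC addrA.
Qed.

Lemma pairwise_swap h : pairwise h -> pairwise (fun a b c => h a c b).
Proof.
move=> [p [q [r E]]].
exists (fun a b => r b a), (fun b c => q c b), (fun c a => p a c) => a b c.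
by rewrite E [LHS]addrC [p a c + _]addrC addrA.
Qed.

(** Mixed differences at 0: subtracting the value at a zero argument leaves [h] unchanged, but
    cancels the summand that does not involve that argument. *)
Lemma pairwise_eq0 h :
    (forall b c, h 0 b c = 0) -> (forall a c, h a 0 c = 0) ->
    (forall a b, h a b 0 = 0) ->
  pairwise h -> forall a b c, h a b c = 0.
Proof.
move=> h1 h2 h3 [p [q [r E]]].
have E1 a b c : h a b c = (p a b - p 0 b) + (r c a - r c 0).
  transitivity (h a b c - h 0 b c); first by rewrite h1 subr0.
  rewrite !E [p a b + _]addrC [p 0 b + _]addrC.
  rewrite -[q b c + p a b + _]addrA -[q b c + p 0 b + _]addrA.
  by rewrite opprD addrACA subrr add0r opprD addrACA.
(* After [q] and [r] are gone, the right-hand side no longer depends on [c], so [c] may be set to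
   0. *)
have E2 a b c : h a b c = (p a b - p 0 b) - (p a 0 - p 0 0).
  transitivity (h a b c - h a 0 c); first by rewrite h2 subr0.
  by rewrite !E1 opprD addrACA subrr addr0.
by move=> a b c; rewrite E2 -(E2 a b 0) h3.
Qed.

(** Additivity of [F a] splits [F a (g b c)] along the decomposition of [g]; every term other than
    [F a (G b c)] misses one of the three variables. *)
Lemma pairwise_compr f g F G u v s t :
    (forall a b, f a b = F a b + u a + v b) ->
    (forall a b, g a b = G a b + s a + t b) ->
    (forall a, {morph F a : x y / x + y}) ->
  pairwise (fun a b c => f a (g b c) - F a (G b c)).
Proof.
move=> fE gE FD.
exists (fun a b => F a (s b) + u a), (fun b c => v (g b c)),
  (fun c a => F a (t c)) => a b c.
rewrite fE {1}gE !FD [LHS]addrC !addrA addNr add0r.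
by rewrite [F a (s b) + _ + u a]addrAC [LHS]addrAC.
Qed.

Lemma pairwise_compl f g F G u v s t :
    (forall a b, f a b = F a b + u a + v b) ->
    (forall a b, g a b = G a b + s a + t b) ->
    (forall b, {morph F^~ b : x y / x + y}) ->
  pairwise (fun a b c => f (g a b) c - F (G a b) c).
Proof.
move=> fE gE FD.
have fE' a b : f b a = F b a + v a + u b by rewrite fE addrAC.
have gE' a b : g b a = G b a + t a + s b by rewrite gE addrAC.
(* The right-hand case for the opposite operations; permuting the variables then restores their
   order. *)
have gfP := pairwise_compr (f := fun a b => f b a) (g := fun a b => g b a)
  (F := fun a b => F b a) fE' gE' FD.
exact: pairwise_rot (pairwise_rot (pairwise_swap gfP)).
Qed.

End Pairwise.

Section Linear.

Variables (F : fieldType) (P : lmodType F).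
Implicit Type h : P -> P -> P.

Lemma linear_sub (U V : lmodType F) (h k : U -> V) :
  linear h -> linear k -> linear (fun x => h x - k x).
Proof.
by move=> hL kL c x y; rewrite hL kL opprD addrACA scalerBr.
Qed.

Lemma linear_morphD (U V : lmodType F) (h : U -> V) :
  linear h -> {morph h : x y / x + y}.
Proof. by move=> hL x y; rewrite -[x]scale1r hL !scale1r. Qed.

Lemma bilinear_morphDr h :
  bilinear_op h -> forall a, {morph h a : x y / x + y}.
Proof. by move=> [hL _] a; apply: linear_morphD. Qed.

Lemma bilinear_morphDl h :
  bilinear_op h -> forall b, {morph h^~ b : x y / x + y}.
Proof. by move=> [_ hL] b; apply: (linear_morphD (hL b)). Qed.

Lemma bilinear_op0r h :
  bilinear_op h -> forall a, h a 0 = 0.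
Proof.
by move=> hB a; apply: (addrI (h a 0)); rewrite -bilinear_morphDr // !addr0.
Qed.

Lemma bilinear_op0l h :
  bilinear_op h -> forall b, h 0 b = 0.
Proof.
move=> hB b; apply: (addrI (h 0 b)).
by rewrite -(bilinear_morphDl hB) !addr0.
Qed.

End Linear.

Section Tangent.

Variables (F : fieldType) (A : affineSpaceType F) (o : A).
Local Notation T := (tangent o).
Implicit Types (f g mul br : A -> A -> A).

Lemma heap_tangent (a b c : A) : heap a b c = (a : T) - (b : T) + (c : T).
Proof.
(* This is [a - b + c] with the operations of the tangent space unfolded. *)
transitivity (heap (heap a o (heap o b o)) o c); last by [].
by rewrite -(heapA a o o b o) heapKr heapA heapKl.
Qed.

Lemma act_tangent (k : F) (a b : A) :
  act k a b = k *: (b : T) - k *: (a : T) + (a : T).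
Proof. by rewrite (act_base k a b o) heap_tangent. Qed.

Lemma heap5_tangent (a b c d e : A) :
  heap5 a b c d e = (a : T) - (b : T) + (c : T) - (d : T) + (e : T).
Proof. by rewrite /heap5 !heap_tangent. Qed.

Lemma linear_affine_map (h : A -> A) : affine_map h ->
  linear (fun x : T => (h x : T) - (h o : T)).
Proof.
move=> [hH hA] k x y.
rewrite [k *: x + y]/(heap (act k o x) o y) hH hA heap_tangent act_tangent.
by rewrite addrK scalerBr addrA.
Qed.

(** In each argument, [linearise f o] is the difference of the linear parts of two affine maps: [f]
    with the other argument fixed, and [f] with it set to [o]. *)
Lemma linearise_bilinear f :
  biaffine_map f -> bilinear_op (linearise f o).
Proof.
move=> [fr fl]; split=> [a | b] k x y.
- have E z : linearise f o a z = (f a z : T) - (f a o : T)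
      - ((f o z : T) - (f o o : T)) by rewrite opprB addrA.
  rewrite !E.
  exact: (linear_sub (linear_affine_map (fr a)) (linear_affine_map (fr o))).
- have E z : linearise f o z b = (f z b : T) - (f o b : T)
      - ((f z o : T) - (f o o : T)).
    rewrite /linearise -addrA addrACA opprB [RHS]addrACA.
    by congr (_ + _); apply: addrC.
  rewrite !E.
  exact: (linear_sub (linear_affine_map (fl b)) (linear_affine_map (fl o))).
Qed.

Lemma linearise_decomp f (a b : T) :
  f a b = linearise f o a b + ((f a o : T) - (f o o : T)) + (f o b : T).
Proof. by rewrite /linearise addrAC subrK addrAC addrA subrK subrK. Qed.

Lemma linearise_eq0 f (a b : T) : linearise f o a b = 0 ->
  (f a b : T) = ((f a o : T) - (f o o : T)) + (f o b : T).
Proof. by move=> f0; rewrite [LHS]linearise_decomp f0 add0r. Qed.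

Lemma linearise_compr f g : biaffine_map f ->
  pairwise (fun a b c : T => (f a (g b c) : T)
                             - linearise f o a (linearise g o b c)).
Proof.
move=> fB; exact: (pairwise_compr (V := T) (@linearise_decomp f)
  (@linearise_decomp g) (bilinear_morphDr (linearise_bilinear fB))).
Qed.

Lemma linearise_compl f g : biaffine_map f ->
  pairwise (fun a b c : T => (f (g a b) c : T)
                             - linearise f o (linearise g o a b) c).
Proof.
move=> fB; exact: (pairwise_compl (V := T) (@linearise_decomp f)
  (@linearise_decomp g) (bilinear_morphDl (linearise_bilinear fB))).
Qed.

Lemma linearise_assoc mul : associative_affgebra mul ->
  associative (linearise mul o).
Proof.
move=> [mB mA] a b c; apply/eqP; rewrite -subr_eq0; apply/eqP; move: a b c.
have lB := linearise_bilinear mB.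
apply: pairwise_eq0 => [b c|a c|a b|].
- by rewrite !(bilinear_op0l lB) subrr.
- by rewrite (bilinear_op0l lB) !(bilinear_op0r lB) (bilinear_op0l lB) subrr.
- by rewrite !(bilinear_op0r lB) subrr.
have P1 := linearise_compl mul mB; have P2 := linearise_compr mul mB.
apply: eq_pairwise (pairwiseB P1 P2) => a b c.
by rewrite mA [X in _ + X]opprB [LHS]addrC [LHS]addrA [X in X + _]subrK.
Qed.

Lemma linearise_alternating br : affine_lie_bracket br ->
  forall a : T, linearise br o a a = 0.
Proof.
(* Affine antisymmetry at [a] and [o] expresses [br o o] by the other three terms of
   [linearise br o a a]. *)
move=> [_ brA _] a; have := brA a o; rewrite heap_tangent => /esym E.
by rewrite /linearise E !addrA subrK subrr add0r subrr.
Qed.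

Lemma linearise_jacobi br : affine_lie_bracket br ->
  forall a b c : T,
    linearise br o a (linearise br o b c)
    + linearise br o b (linearise br o c a)
    + linearise br o c (linearise br o a b) = 0.
Proof.
move=> [brB _ brJ]; have lB := linearise_bilinear brB.
have l0 := (bilinear_op0l lB, bilinear_op0r lB).
apply: pairwise_eq0 => [b c|a c|a b|].
- by rewrite !l0 !addr0.
- by rewrite !l0 !addr0.
- by rewrite !l0 !addr0.
have P1 := linearise_compr br brB.
have P2 := pairwise_rot P1; have P3 := pairwise_rot P2.
(* The correction terms of the affine Jacobi identity, each a function of one variable. *)
pose cube (x : T) : T := br x (br x x).
have E : pairwise (fun a b c : T =>
    (br a (br b c) : T) + (br b (br c a) : T) + (br c (br a b) : T)).
  exists (fun a _ => cube a), (fun b _ => cube b), (fun c _ => cube c) => a b c.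
  by apply: subrD_eq; have := brJ a b c; rewrite heap5_tangent.
apply: eq_pairwise (pairwiseB E (pairwiseD (pairwiseD P1 P2) P3)) => a b c.
exact: addr3_subBBB.
Qed.

Lemma linearise_leibniz mul br : one_sided_poisson_affgebra mul br ->
  forall x y z : T,
    linearise br o (linearise mul o x y) z
    = linearise mul o x (linearise br o y z)
      + linearise mul o (linearise br o x z) y.
Proof.
move=> [[mB mA] [brB _ _] der] x y z.
apply/eqP; rewrite eq_sym -subr_eq0; apply/eqP; move: x y z.
have lm := linearise_bilinear mB; have lb := linearise_bilinear brB.
have l0 := (bilinear_op0l lm, bilinear_op0r lm,
  bilinear_op0l lb, bilinear_op0r lb).
apply: pairwise_eq0 => [b c|a c|a b|].
- by rewrite !l0 addr0 subrr.
- by rewrite !l0 addr0 subrr.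
- by rewrite !l0 addr0 subrr.
have P1 := linearise_compl mul brB.
have P2 := linearise_compr br mB.
have P3 := pairwise_swap (linearise_compl br mB).
(* The deriffation condition at [o] kills the bilinear part of [Delta mul (br^~ c)] in [a] and [b];
   what remains depends on [a] and [c] or on [b] and [c] only. *)
have E : pairwise (fun a b c : T => Delta mul (br^~ c) a b : T).
  exists (fun _ _ => 0),
    (fun b c => (Delta mul (br^~ c) o b : T)),
    (fun c a => (Delta mul (br^~ c) a o : T) - (Delta mul (br^~ c) o o : T)).
  move=> a b c; rewrite add0r [RHS]addrC; apply: linearise_eq0.
  by have [_] := der c; apply.
apply: eq_pairwise (pairwiseB E (pairwiseB (pairwiseD P2 P3) P1)) => a b c.
rewrite /Delta heap_tangent.
exact: subrD_subBBB.
Qed.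

End Tangent.

Theorem proposition4p2 (F : fieldType) (A : affineSpaceType F)
    (mul br : A -> A -> A) (o : A) :
  one_sided_poisson_affgebra mul br ->
  @poisson_algebra F (tangent o) (linearise mul o) (linearise br o).
Proof.
move=> mbP; have [mA brL _] := mbP; have [mB _] := mA; have [brB _ _] := brL.
split; [split | | |].
- exact: linearise_bilinear.
- exact: linearise_alternating.
- exact: linearise_jacobi.
- exact: linearise_bilinear.
- exact: linearise_assoc.
- exact: linearise_leibniz.
Qed.
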